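(* Let $\alpha>-1$, $\beta>-1$ be real, let $P_n^{(-1)}(x)$ be the monic little $-1$ Jacobi polynomials with parameters $(\alpha,\beta)$, and let $\tilde P_n(x)$ be the monic little $-1$ Jacobi polynomials with parameters $(\alpha,\beta+2)$. Put $\mu=\alpha/2$. Then for every $n\ge1$, $$T_\mu P_n^{(-1)}(x)=[n]_\mu\,\tilde P_{n-1}(x),\qquad [n]_\mu=n+(1-(-1)^n)\mu.$$
   Context: The Dunkl operator $T_\mu$ acts on polynomials by $T_\mu f(x)=f'(x)+\mu\,\frac{f(x)-f(-x)}{x}$. The little $-1$ Jacobi polynomials with parameters $(\alpha,\beta)$ are the monic polynomials defined by $P_{-1}=0$, $P_0=1$, $P_{n+1}(x)+b_nP_n(x)+u_nP_{n-1}(x)=xP_n(x)$ with $$u_n=\frac{(n+(1-\theta_n)\alpha)(n+\beta+\theta_n\alpha)}{(2n+\alpha+\beta)^2},\quad b_n=(-1)^n\frac{(2n+1)\alpha+\alpha\beta+\alpha^2+(-1)^n\beta}{(2n+\alpha+\beta)(2n+2+\alpha+\beta)},\quad \theta_n=\frac{1+(-1)^n}{2}$$ (with $b_0=\frac{\alpha+1}{\alpha+\beta+2}$, which is the value of the formula at $n=0$ when $\alpha+\beta\ne0$). Equivalently, they are the monic polynomials orthogonal on $[-1,1]$ with respect to the weight $|x|^{\alpha}(1-x^2)^{(\beta-1)/2}(1+x)$. *)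

(* Defs.v *)
From HB Require Import structures.
From mathcomp Require Import all_boot all_order all_algebra.
From mathcomp Require Import ring.

Set Implicit Arguments.
Unset Strict Implicit.
Unset Printing Implicit Defensive.

Import Order.TTheory GRing.Theory Num.Theory.
Local Open Scope ring_scope.

(* The division by 'X is exact: see dunkl_divXK and horner_dunkl below. *)
Definition dunkl (R : fieldType) (mu : R) (f : {poly R}) : {poly R} :=
  f^`() + mu *: ((f - (f \Po (- 'X))) %/ 'X).

Definition dunkl_nat (R : fieldType) (mu : R) (n : nat) : R :=
  n%:R + (1 - (-1) ^+ n) * mu.

Definition theta (R : fieldType) (n : nat) : R := (1 + (-1) ^+ n) / 2.

Definition jacobi_u (R : fieldType) (alpha beta : R) (n : nat) : R :=
  (n%:R + (1 - theta R n) * alpha) * (n%:R + beta + theta R n * alpha)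
  / (2 * n%:R + alpha + beta) ^+ 2.

Definition jacobi_b_gen (R : fieldType) (alpha beta : R) (n : nat) : R :=
  (-1) ^+ n *
  (((2 * n%:R + 1) * alpha + alpha * beta + alpha ^+ 2 + (-1) ^+ n * beta)
   / ((2 * n%:R + alpha + beta) * (2 * n%:R + 2 + alpha + beta))).

(* At n = 0 the general formula is 0 / 0 when alpha + beta = 0; its
   simplified value is used there, see jacobi_b0. *)
Definition jacobi_b (R : fieldType) (alpha beta : R) (n : nat) : R :=
  if n is 0 then (alpha + 1) / (alpha + beta + 2)
  else jacobi_b_gen alpha beta n.

(* The inner match is the convention P_{-1} = 0. *)
Fixpoint little_jacobi (R : fieldType) (alpha beta : R) (n : nat) : {poly R} :=
  if n is m.+1 then
    'X * little_jacobi alpha beta m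
    - jacobi_b alpha beta m *: little_jacobi alpha beta m
    - jacobi_u alpha beta m *:
        (if m is k.+1 then little_jacobi alpha beta k else 0)
  else 1.

Lemma dunkl_divXK (R : fieldType) (f : {poly R}) :
  (f - (f \Po (- 'X))) %/ 'X * 'X = f - (f \Po (- 'X)).
Proof.
have := dvdp_XsubCl (f - (f \Po (- 'X))) 0; rewrite polyC0 subr0 => dvdX.
apply: divpK; rewrite dvdX rootE.
by rewrite hornerD hornerN horner_comp hornerN hornerX oppr0 subrr.
Qed.

Lemma horner_dunkl (R : fieldType) (mu : R) (f : {poly R}) (x : R) :
  x != 0 -> (dunkl mu f).[x] = f^`().[x] + mu * ((f.[x] - f.[- x]) / x).
Proof.
move=> x0; rewrite /dunkl hornerD hornerZ; congr (_ + _ * _).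
apply: (mulIf x0); rewrite divfK //.
have /(congr1 (horner^~ x)) := dunkl_divXK f.
by rewrite hornerM hornerX hornerD hornerN horner_comp hornerN hornerX.
Qed.

Lemma jacobi_b0 (R : fieldType) (alpha beta : R) :
  alpha + beta != 0 -> jacobi_b alpha beta 0 = jacobi_b_gen alpha beta 0.
Proof.
move=> ab0; have -> : jacobi_b_gen alpha beta 0 =
    ((alpha + beta) * (alpha + 1)) / ((alpha + beta) * (alpha + beta + 2)).
  by rewrite /jacobi_b_gen expr0 mul1r; congr (_ / _); ring.
by rewrite -mulf_div divff // mul1r.
Qed.

Lemma little_jacobi_rec (R : fieldType) (alpha beta : R) (n : nat) :
  little_jacobi alpha beta n.+2 + jacobi_b alpha beta n.+1 *:
    little_jacobi alpha beta n.+1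
  + jacobi_u alpha beta n.+1 *: little_jacobi alpha beta n
  = 'X * little_jacobi alpha beta n.+1.
Proof. by rewrite [little_jacobi _ _ n.+2]/= addrAC !subrK. Qed.

(* Main.v *)
(* Write Q_n for the polynomials with parameters (alpha, beta + 2). Since their
   weight is (1 - x^2) times that of P_n, orthogonality shows that P_n(x) and
   P_n(-x) are both combinations of Q_n, Q_{n-1} and Q_{n-2}. Applying T_mu to
   the recurrence of P_n, through T_mu(x f) = x T_mu f + f + 2 mu f(-x), then
   expresses everything in the Q_k, so an induction on n reduces the claim to
   rational identities between coefficients. *)
Require Import Defs.
From mathcomp Require Import all_boot all_order all_algebra.
From mathcomp Require Import reals.
From mathcomp Require Import ring lra.
Import Order.TTheory GRing.Theory Num.Theory.
Local Open Scope ring_scope.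

Set Implicit Arguments.
Unset Strict Implicit.
Unset Printing Implicit Defensive.

(** * Algebra of the Dunkl operator *)

Lemma dunklMX (R : fieldType) (mu : R) (f : {poly R}) :
  dunkl mu f * 'X = 'X * f^`() + mu *: (f - (f \Po (- 'X))).
Proof. by rewrite /dunkl mulrDl -scalerAl dunkl_divXK [_ * f^`()]mulrC. Qed.

(** Multiplication by ['X] is injective on polynomials, so a value of [dunkl] may be checked after
    clearing the division. *)
Lemma dunkl_eq (R : fieldType) (mu : R) (f g : {poly R}) :
  'X * f^`() + mu *: (f - (f \Po (- 'X))) = g * 'X -> dunkl mu f = g.
Proof. by rewrite -dunklMX; apply: mulIf; rewrite polyX_eq0. Qed.

Lemma dunkl1 (R : fieldType) (mu : R) : dunkl mu 1 = 0.
Proof.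
apply: dunkl_eq; rewrite -polyC1 derivC comp_polyC subrr scaler0.
by rewrite mulr0 mul0r addr0.
Qed.

Lemma dunklB (R : fieldType) (mu : R) (f g : {poly R}) :
  dunkl mu (f - g) = dunkl mu f - dunkl mu g.
Proof.
apply: dunkl_eq; rewrite mulrBl !dunklMX derivB comp_polyB -!mul_polyC; ring.
Qed.

Lemma dunklZ (R : fieldType) (mu a : R) (f : {poly R}) :
  dunkl mu (a *: f) = a *: dunkl mu f.
Proof.
apply: dunkl_eq; rewrite -scalerAl dunklMX derivZ comp_polyZ -!mul_polyC; ring.
Qed.

Lemma dunkl_mulX (R : fieldType) (mu : R) (f : {poly R}) :
  dunkl mu ('X * f) = 'X * dunkl mu f + f + (2 * mu) *: (f \Po (- 'X)).
Proof.
apply: dunkl_eq.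
rewrite derivM derivX comp_polyM comp_polyX !mulrDl -mulrA dunklMX -!mul_polyC.
ring.
Qed.

(* The predecessors are truncated: the hypotheses make the coefficients of the
   spurious terms vanish. *)
Lemma three_term_connection (R : fieldType) (p q : nat -> {poly R})
    (tau : R) (b u b' u' t c d : nat -> R) :
  (forall n, 'X * q n = q n.+1 + b' n *: q n + u' n *: q n.-1) ->
  (forall n, p n.+2 =
     tau *: ('X * p n.+1) - b n.+1 *: p n.+1 - u n.+1 *: p n) ->
  (forall n, t n.+2 = tau * t n.+1) ->
  (forall n, c n.+2 = tau * (t n.+1 * b' n.+1 + c n.+1) - b n.+1 * t n.+1) ->
  (forall n, d n.+2 = tau * (t n.+1 * u' n.+1 + c n.+1 * b' n + d n.+1)
     - b n.+1 * c n.+1 - u n.+1 * t n) ->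
  (forall n, tau * (c n.+1 * u' n + d n.+1 * b' n.-1)
     - b n.+1 * d n.+1 - u n.+1 * c n = 0) ->
  (forall n, tau * (d n.+1 * u' n.-1) - u n.+1 * d n = 0) ->
  d 1 = 0 ->
  p 0 = t 0 *: q 0 + c 0 *: q 0 + d 0 *: q 0 ->
  p 1 = t 1 *: q 1 + c 1 *: q 0 + d 1 *: q 0 ->
  forall n, p n = t n *: q n + c n *: q n.-1 + d n *: q n.-2.
Proof.
move=> hq hp ht hc hd h0 h1 d1 p0 p1 n.
(* The recurrence has order two, so two consecutive indices are carried. *)
suff [] : p n = t n *: q n + c n *: q n.-1 + d n *: q n.-2 /\
    p n.+1 = t n.+1 *: q n.+1 + c n.+1 *: q n + d n.+1 *: q n.-1 by [].
elim: n => [|n [IH0 IH1]]; first by [].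
split=> //=.
have Xq : 'X * p n.+1 = t n.+1 *: ('X * q n.+1) + c n.+1 *: ('X * q n)
    + d n.+1 *: ('X * q n.-1) by rewrite IH1 -!mul_polyC; ring.
apply/eqP; rewrite -subr_eq0; apply/eqP.
(* Only the terms in [q n.-1] and [q n.-2] have no counterpart in the expansion of [p n.+2]; their
   coefficients must vanish. *)
transitivity ((tau * (c n.+1 * u' n + d n.+1 * b' n.-1)
     - b n.+1 * d n.+1 - u n.+1 * c n) *: q n.-1 +
   (tau * (d n.+1 * u' n.-1) - u n.+1 * d n) *: q n.-2); last first.
  by rewrite h0 h1 !scale0r addr0.
rewrite hp Xq !hq IH1 IH0 ht hc hd -!mul_polyC.
(* At n = 0, [q n.-1.+1] is [q 1] instead of [q 0], but it comes with the factor [d 1 = 0]. *)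
case: n {IH0 IH1 Xq} => [|n] /=; last first.
  by ring.
by rewrite d1; ring.
Qed.

(** * Recurrence and connection coefficients *)

Lemma jacobi_uE (R : realType) (alpha beta : R) (n : nat) :
  jacobi_u alpha beta n = dunkl_nat (alpha / 2) n
    * (2 * n%:R + alpha + beta - dunkl_nat (alpha / 2) n)
    / (2 * n%:R + alpha + beta) ^+ 2.
Proof.
rewrite /jacobi_u /theta /dunkl_nat; congr (_ / _).
by rewrite -signr_odd; case: (odd n); rewrite ?expr0 ?expr1; field.
Qed.

(** Positivity lets the special value of b_0 join the general formula. It holds wherever the lemma
    is used: there b_n has n >= 1, or beta + 2 in place of beta. *)
Lemma jacobi_bE (R : realType) (alpha beta : R) (n : nat) :
  0 < 2 * n%:R + alpha + beta ->
  jacobi_b alpha beta n =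
    ((-1) ^+ n * alpha * (2 * n%:R + alpha + beta + 1) + beta)
    / ((2 * n%:R + alpha + beta) * (2 * n%:R + alpha + beta + 2)).
Proof.
move=> D0; have -> : jacobi_b alpha beta n = jacobi_b_gen alpha beta n.
  by case: n D0 => [|//] D0; apply: jacobi_b0; apply: lt0r_neq0; lra.
rewrite /jacobi_b_gen mulrA; congr (_ / _); last by ring.
by rewrite -signr_odd; case: (odd n); rewrite ?expr0 ?expr1; ring.
Qed.

(** Coefficient of Q_{n-1} in P_n. With b' the coefficients for beta + 2, it is the telescoping sum
    of b'_k - b_k over k < n. *)
Definition conn_c (R : realType) (alpha beta : R) (n : nat) : R :=
  - 2 * dunkl_nat (alpha / 2) n
  / ((2 * n%:R + alpha + beta) * (2 * n%:R + alpha + beta + 2)).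

(** Coefficient of Q_{n-2} in P_n. The recurrences force d_{n+1} u'_{n-1} = u_{n+1} d_n, with u'
    taken for beta + 2. *)
Definition conn_d (R : realType) (alpha beta : R) (n : nat) : R :=
  - (dunkl_nat (alpha / 2) n * dunkl_nat (alpha / 2) n.-1)
  / (2 * n%:R + alpha + beta) ^+ 2.

Definition refl_c (R : realType) (alpha beta : R) (n : nat) : R :=
  - (-1) ^+ n * (2 * n%:R + alpha + beta + 1) * conn_c alpha beta n.

(** Coefficient of Q_{n-2} in P_n(-x). The sign compares the leading coefficients of (1-x)^2
    Q_{n-2}(-x) and (1-x^2) Q_{n-2}(x), integrated against P_n and its weight. *)
Definition refl_d (R : realType) (alpha beta : R) (n : nat) : R :=
  - (-1) ^+ n * conn_d alpha beta n.

Lemma dunkl_nat0 (R : realType) (mu : R) : dunkl_nat mu 0 = 0.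
Proof. by rewrite /dunkl_nat expr0 subrr mul0r addr0. Qed.

Lemma signr_cases (R : pzRingType) (n : nat) :
  (-1) ^+ n = 1 :> R \/ (-1) ^+ n = -1 :> R.
Proof. by rewrite -signr_odd; case: (odd n); [right | left]. Qed.

Ltac coef_neq0 :=
  repeat (apply/andP; split); apply: lt0r_neq0; lra.

(** Parity enters only through (-1)^n; once this sign is fixed, the identity is rational with
    positive denominators. *)
Ltac coef_identity R n :=
  rewrite ?jacobi_uE ?jacobi_bE /refl_c /refl_d /conn_c /conn_d /=
    ?dunkl_nat0 /dunkl_nat ?exprS; try lra;
  have [-> | ->] := signr_cases R n; field; coef_neq0.

(** At n = 0 the vanishing of u_0 stands in for the convention P_{-1} = 0. *)
Lemma little_jacobi_mulX (R : realType) (alpha beta : R) (n : nat) :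
  'X * little_jacobi alpha beta n = little_jacobi alpha beta n.+1
    + jacobi_b alpha beta n *: little_jacobi alpha beta n
    + jacobi_u alpha beta n *: little_jacobi alpha beta n.-1.
Proof.
case: n => [|n]; last by rewrite -little_jacobi_rec.
by rewrite [jacobi_u _ _ _]jacobi_uE dunkl_nat0 /= !mul0r !scale0r; ring.
Qed.

Lemma jacobi_u0 (R : realType) (alpha beta : R) : jacobi_u alpha beta 0 = 0.
Proof. by rewrite jacobi_uE dunkl_nat0 !mul0r. Qed.

Lemma conn_c0 (R : realType) (alpha beta : R) : conn_c alpha beta 0 = 0.
Proof. by rewrite /conn_c dunkl_nat0 mulr0 mul0r. Qed.

Lemma conn_d0 (R : realType) (alpha beta : R) : conn_d alpha beta 0 = 0.
Proof. by rewrite /conn_d dunkl_nat0 mul0r oppr0 mul0r. Qed.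

Lemma conn_d1 (R : realType) (alpha beta : R) : conn_d alpha beta 1 = 0.
Proof. by rewrite /conn_d dunkl_nat0 mulr0 oppr0 mul0r. Qed.

Lemma little_jacobi_1 (R : fieldType) (alpha beta : R) :
  little_jacobi alpha beta 1 = 'X - ((alpha + 1) / (alpha + beta + 2))%:P.
Proof. by rewrite /= scaler0 subr0 mulr1 alg_polyC. Qed.

Lemma little_jacobiSS (R : fieldType) (alpha beta : R) (n : nat) :
  little_jacobi alpha beta n.+2 = 'X * little_jacobi alpha beta n.+1
    - jacobi_b alpha beta n.+1 *: little_jacobi alpha beta n.+1
    - jacobi_u alpha beta n.+1 *: little_jacobi alpha beta n.
Proof. by []. Qed.

Lemma little_jacobi_connection (R : realType) (alpha beta : R) (n : nat) :
  -1 < alpha -> -1 < beta ->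
  little_jacobi alpha beta n = little_jacobi alpha (beta + 2) n
    + conn_c alpha beta n *: little_jacobi alpha (beta + 2) n.-1
    + conn_d alpha beta n *: little_jacobi alpha (beta + 2) n.-2.
Proof.
move=> ha hb; rewrite -[X in _ = X + _ + _]scale1r.
have n0 m : 0 <= m%:R :> R by [].
apply: (three_term_connection (p := little_jacobi alpha beta)
  (q := little_jacobi alpha (beta + 2)) (tau := 1) (b := jacobi_b alpha beta)
  (u := jacobi_u alpha beta) (b' := jacobi_b alpha (beta + 2))
  (u' := jacobi_u alpha (beta + 2)) (t := fun=> 1)) => [m|m|m|m|m|m|m|||].
- exact: little_jacobi_mulX.
- by rewrite scale1r.
- by rewrite mulr1.
- by have := n0 m => m0; coef_identity R m.
- by have := n0 m => m0; coef_identity R m.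
(* At m = 0 the denominator of [conn_c] contains alpha + beta, which may be zero, but every term
   vanishes. *)
- case: m => [|m]; first by rewrite jacobi_u0 conn_c0 conn_d1; ring.
  by have := n0 m => m0; coef_identity R m.
- case: m => [|m]; first by rewrite conn_d0 conn_d1; ring.
  by have := n0 m => m0; coef_identity R m.
- exact: conn_d1.
- by rewrite conn_c0 conn_d0 !scale0r scale1r !addr0.
- rewrite conn_d1 scale0r addr0 scale1r !little_jacobi_1 alg_polyC.
  (* This is c_1 = b'_0 - b_0. *)
  suff -> : conn_c alpha beta 1 = (alpha + 1) / (alpha + (beta + 2) + 2)
      - (alpha + 1) / (alpha + beta + 2) by rewrite polyCB; ring.
  by rewrite /conn_c /dunkl_nat expr1; field; coef_neq0.
Qed.

(** Substituting -x turns multiplication by x into its negative, hence [tau := -1]. *)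
Lemma little_jacobi_reflection (R : realType) (alpha beta : R) (n : nat) :
  -1 < alpha -> -1 < beta ->
  little_jacobi alpha beta n \Po (- 'X) =
    (-1) ^+ n *: little_jacobi alpha (beta + 2) n
    + refl_c alpha beta n *: little_jacobi alpha (beta + 2) n.-1
    + refl_d alpha beta n *: little_jacobi alpha (beta + 2) n.-2.
Proof.
move=> ha hb.
have n0 m : 0 <= m%:R :> R by [].
apply: (three_term_connection
  (p := fun m => little_jacobi alpha beta m \Po (- 'X))
  (q := little_jacobi alpha (beta + 2)) (tau := -1) (b := jacobi_b alpha beta)
  (u := jacobi_u alpha beta) (b' := jacobi_b alpha (beta + 2))
  (u' := jacobi_u alpha (beta + 2)) (t := fun m => (-1) ^+ m))
  => [m|m|m|m|m|m|m|||].
- exact: little_jacobi_mulX.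
- rewrite little_jacobiSS.
  move: (little_jacobi _ _ m.+1) (little_jacobi _ _ m) => f g.
  rewrite !comp_polyB !comp_polyZ comp_polyM.
  by rewrite comp_polyX mulNr scaleN1r.
- by rewrite exprS.
- by have := n0 m => m0; coef_identity R m.
- by have := n0 m => m0; coef_identity R m.
- case: m => [|m].
    by rewrite /refl_c /refl_d jacobi_u0 conn_c0 conn_d1; ring.
  by have := n0 m => m0; coef_identity R m.
- case: m => [|m]; first by rewrite /refl_d conn_d0 conn_d1; ring.
  by have := n0 m => m0; coef_identity R m.
- by rewrite /refl_d conn_d1 mulr0.
- rewrite /refl_c /refl_d conn_c0 conn_d0 !mulr0 !scale0r scale1r !addr0.
  by rewrite /= -polyC1 comp_polyC.
- rewrite /refl_d conn_d1 mulr0 scale0r addr0 expr1 scaleN1r !little_jacobi_1.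
  rewrite alg_polyC comp_polyB comp_polyX comp_polyC.
  suff -> : refl_c alpha beta 1 = - ((alpha + 1) / (alpha + beta + 2))
      - (alpha + 1) / (alpha + (beta + 2) + 2) by rewrite polyCB polyCN; ring.
  by rewrite /refl_c /conn_c /dunkl_nat expr1; field; coef_neq0.
Qed.

(** * Induction on the degree *)

Lemma dunkl_little_jacobi (R : realType) (alpha beta : R) (n : nat) :
  -1 < alpha -> -1 < beta ->
  dunkl (alpha / 2) (little_jacobi alpha beta n) =
  dunkl_nat (alpha / 2) n *: little_jacobi alpha (beta + 2) n.-1.
Proof.
move=> ha hb.
suff [] : dunkl (alpha / 2) (little_jacobi alpha beta n) =
    dunkl_nat (alpha / 2) n *: little_jacobi alpha (beta + 2) n.-1 /\
    dunkl (alpha / 2) (little_jacobi alpha beta n.+1) =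
    dunkl_nat (alpha / 2) n.+1 *: little_jacobi alpha (beta + 2) n by [].
have T0 : dunkl (alpha / 2) (little_jacobi alpha beta 0) = 0 by exact: dunkl1.
elim: n => [|n [IH0 IH1]].
  split; first by rewrite T0 dunkl_nat0 scale0r.
  rewrite /= scaler0 subr0 dunklB dunklZ dunkl_mulX dunkl1 scaler0 subr0 mulr0.
  have -> : 1 \Po (- 'X) = 1 :> {poly R} by rewrite -polyC1 comp_polyC.
  rewrite add0r -[X in X + _]scale1r -scalerDl; congr (_ *: _).
  by rewrite /dunkl_nat expr1; field.
split=> //; rewrite little_jacobiSS dunklB dunklB !dunklZ dunkl_mulX.
rewrite IH0 IH1 -scalerAr little_jacobi_mulX little_jacobi_reflection //.
rewrite (little_jacobi_connection (beta := beta) n.+1) // [n.+1.-1]/=.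
have n0 : 0 <= n%:R :> R by [].
(* [e1], [e2] and [e3] compare the coefficients of Q_{n+1}, Q_n and Q_{n-1} in T_mu P_{n+2}. *)
have e1 : dunkl_nat (alpha / 2) n.+1 + 1 + 2 * (alpha / 2) * (-1) ^+ n.+1
   = dunkl_nat (alpha / 2) n.+2 by coef_identity R n.
have e2 : dunkl_nat (alpha / 2) n.+1 * jacobi_b alpha (beta + 2) n
   + conn_c alpha beta n.+1 + 2 * (alpha / 2) * refl_c alpha beta n.+1
   - jacobi_b alpha beta n.+1 * dunkl_nat (alpha / 2) n.+1 = 0
  by coef_identity R n.
have e3 : dunkl_nat (alpha / 2) n.+1 * jacobi_u alpha (beta + 2) n
   + conn_d alpha beta n.+1 + 2 * (alpha / 2) * refl_d alpha beta n.+1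
   - jacobi_u alpha beta n.+1 * dunkl_nat (alpha / 2) n = 0
  by coef_identity R n.
rewrite -e1; apply/eqP; rewrite -subr_eq0; apply/eqP.
move: (little_jacobi _ _ n.+1) (little_jacobi _ _ n) (little_jacobi _ _ n.-1)
  => q2 q1 q0.
(* Zero multiples of [q1] and [q0] are inserted so that [e2] and [e3] can replace their
   coefficients. *)
rewrite -[RHS]addr0 -[X in _ = X + _](scale0r q1) -[X in _ = _ + X](scale0r q0).
rewrite -[X in _ = X *: q1 + _]e2 -[X in _ = _ + X *: q0]e3.
rewrite -!mul_polyC; ring.
Qed.

Theorem proposition1 (R : realType) (alpha beta : R)
    (halpha : -1 < alpha) (hbeta : -1 < beta) (n : nat) (hn : (1 <= n)%N) :
  dunkl (alpha / 2) (little_jacobi alpha beta n) =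
  dunkl_nat (alpha / 2) n *: little_jacobi alpha (beta + 2) n.-1.
Proof. exact: dunkl_little_jacobi. Qed.
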